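(* Let $f:G\to G$ be a vertex map on a graph $G$, with linearization $L_f$, and let $k,n$ be positive integers. If there is an edge $E$ in $G$ that has an $n$-horseshoe under $L_f^k$, then $h(L_f)\ge \frac{1}{k}\log n$.
   Context: Graph: a connected space $G$ that is a union of finitely many vertices and finitely many edges $E_1,\dots,E_e$. Each edge is homeomorphic to $[0,1]$, its two boundary points are distinct vertices (no loops), no vertex is an interior point of an edge, and two distinct edges intersect in the empty set, one vertex or two vertices (so several edges may join the same two vertices). Each edge is given unit length via a fixed homeomorphism with $[0,1]$; a path of $m$ edges has length $m$. Vertex map: a continuous map $f:G\to G$ that permutes the vertices of $G$. Linearization: $L_f:G\to G$ agrees with $f$ on vertices, and for each edge $E_i$ with endpoints $V_1,V_2$, $L_f$ maps $E_i$ linearly (i.e. at constant speed with respect to edge length) onto the unique reduced (no backtracking) edge path from $f(V_1)$ to $f(V_2)$ that is homotopic to $f|_{E_i}$ relative to the endpoints of $E_i$. Markov matrix: $M=M(L_f)$ is the $e\times e$ matrix whose entry $M_{i,j}$ is the number of closed subintervals of $E_j$ that $L_f$ maps homeomorphically onto $E_i$ (equivalently, the number of times the edge path $L_f(E_j)$ traverses $E_i$). Entropy: the topological entropy $h(L_f)$ is defined to be $\log\lambda$, where $\lambda$ is the spectral radius of $M(L_f)$. Horseshoe: for a vertex map $g:G\to G$ and positive integers $k,n$, an edge $E$ has an $n$-horseshoe under $g^k$ if there exist closed subintervals $J_1,\dots,J_n$ of $E$, each non-degenerate (with non-empty interior), with pairwise disjoint interiors, such that $J_1\cup\dots\cup J_n\subseteq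 g^k(J_1)\cap\dots\cap g^k(J_n)$. *)

(* Defs.v *)
From mathcomp Require Import all_boot all_order all_algebra.
From mathcomp Require Import finmap complex.
From mathcomp Require Import all_classical all_reals all_analysis.
Import numFieldNormedType.Exports.
Set Implicit Arguments.
Unset Strict Implicit.
Unset Printing Implicit Defensive.
Import Order.TTheory GRing.Theory Num.Theory.
Local Open Scope classical_set_scope.
Local Open Scope ring_scope.

Definition homeo_onto (T U : topologicalType) (A : set T) (B : set U)
    (g : T -> U) : Prop :=
  [/\ set_bij A B g,
      {within A, continuous g} &
      exists2 h : U -> T,
        {within B, continuous h} & forall x, A x -> h (g x) = x].

(* [chart i] is the fixed homeomorphism from [0,1] onto the i-th edge; its
   values outside [0,1] are irrelevant.  The two ends of an edge are distinct
   because [chart i] is injective on [0,1].  Being Hausdorff, the space carries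
   the topology of a finite 1-dimensional CW complex. *)
Record graph (R : realType) := Graph {
  space :> topologicalType;
  vertex : set space;
  nedges : nat;
  chart : 'I_nedges -> R -> space;
  edge := fun i => chart i @` `[0, 1];
  graph_hausdorff : hausdorff_space space;
  graph_connected : connected [set: space];
  vertex_finite : finite_set vertex;
  graph_cover : vertex `|` \bigcup_i edge i = [set: space];
  chart_homeo : forall i,
    homeo_onto (`[0, 1]%classic : set R) (edge i) (chart i);
  chart_vertex : forall i, vertex (chart i 0) /\ vertex (chart i 1);
  chart_interior : forall i (t : R), 0 < t < 1 -> ~ vertex (chart i t);
  edge_meet : forall i j : 'I_nedges, i != j ->
    [\/ edge i `&` edge j = set0,
        exists2 v, vertex v & edge i `&` edge j = [set v] |
        exists v w, [/\ vertex v, vertex w, v <> w &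
                        edge i `&` edge j = [set v; w]]]
}.
Arguments vertex {R} g.
Arguments nedges {R} g.
Arguments chart {R} g i t.
Arguments edge {R} g i.

Section VertexMaps.
Variables (R : realType) (G : graph R).

Definition vertex_map (f : G -> G) : Prop :=
  continuous f /\ set_bij (vertex G) (vertex G) f.

(* An oriented edge; the boolean [true] means that it is run backwards, from
   [chart G i 1] to [chart G i 0]. *)
Definition oedge : Type := ('I_(nedges G) * bool)%type.

Definition oreverse (d : oedge) : oedge := (d.1, ~~ d.2).

Definition ochart (d : oedge) (t : R) : G :=
  chart G d.1 (if d.2 then 1 - t else t).

Fixpoint edge_path (v : G) (p : seq oedge) (w : G) : Prop :=
  if p is d :: p' then ochart d 0 = v /\ edge_path (ochart d 1) p' w
  else v = w.

Definition reduced (p : seq oedge) : bool :=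
  sorted (fun d d' => d' != oreverse d) p.

(* [g], restricted to [0,1], runs along [p] at constant speed: with m = size p,
   the interval [s/m, (s+1)/m] is mapped affinely onto the s-th edge of [p].
   Nothing is required when [p] is empty; this does not occur below, where [p]
   joins the distinct images under [f] of the two ends of an edge. *)
Definition constant_speed_along (p : seq oedge) (g : R -> G) : Prop :=
  forall (s : 'I_(size p)) (u : R), 0 <= u <= 1 ->
    g ((s%:R + u) / (size p)%:R) = ochart (tnth (in_tuple p) s) u.

Definition path_homotopic (g0 g1 : R -> G) : Prop :=
  exists H : R * R -> G,
    [/\ {within (`[0, 1] `*` `[0, 1] : set (R * R)), continuous H},
        forall t : R, 0 <= t <= 1 -> H (t, 0) = g0 t /\ H (t, 1) = g1 t &
        forall s : R, 0 <= s <= 1 -> H (0, s) = g0 0 /\ H (1, s) = g0 1].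

(* A relation, not a function of [f]: each [p], hence [L], is uniquely
   determined by [f], since homotopic reduced edge paths are equal. *)
Definition linearization (f L : G -> G) : Prop :=
  (forall v, vertex G v -> L v = f v) /\
  forall i : 'I_(nedges G), exists p : seq oedge,
    [/\ edge_path (f (chart G i 0)) p (f (chart G i 1)),
        reduced p,
        constant_speed_along p (L \o chart G i) &
        path_homotopic (f \o chart G i) (L \o chart G i)].

(* The closed subintervals of E_j mapped by [L] homeomorphically onto E_i,
   each represented by its pair of end parameters.  For a linearization there
   are finitely many of them, so that [fset_set] does not fall back on its
   default value below. *)
Definition covering_intervals (L : G -> G) (i j : 'I_(nedges G)) :
    set (R * R) :=
  [set ab | [/\ 0 <= ab.1, ab.1 < ab.2, ab.2 <= 1 &
             homeo_onto (chart G j @` `[ab.1, ab.2]) (edge G i) L]].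

Definition markov (L : G -> G) : 'M[R]_(nedges G) :=
  \matrix_(i, j) (#|` fset_set (covering_intervals L i j)|)%:R.

End VertexMaps.

(* The supremum is a maximum over a finite set, nonempty when 0 < n. *)
Definition spectral_radius (R : realType) (n : nat) (A : 'M[R]_n) : R :=
  sup [set complex.Re `|z| | z in
         [set z : R[i] | eigenvalue (map_mx (real_complex R) A) z]].

Definition entropy (R : realType) (G : graph R) (L : G -> G) : R :=
  ln (spectral_radius (markov L)).

(* The subinterval J_l of the edge is the image under the chart of
   [a l, b l]. *)
Definition horseshoe (R : realType) (G : graph R) (n : nat) (g : G -> G)
    (i : 'I_(nedges G)) : Prop :=
  exists a b : 'I_n -> R,
    let J := fun l => chart G i @` `[a l, b l] in
    [/\ forall l, [/\ 0 <= a l, a l < b l & b l <= 1],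
        trivIset [set: 'I_n] (fun l => `]a l, b l[%classic) &
        \bigcup_l J l `<=` \bigcap_l (g @` J l)].

(* Main.v *)
(** Let x be a point of the horseshoe which is neither a vertex nor on the
    forward orbit under L^k of an end of one of the intervals J_l.  Pulling x
    back through the horseshoe gives at least n^m points y of E with
    L^(km) y = x.  As L is affine between preimages of vertices, the number of
    such y is at most the (E,E) entry of M^(km).  Hence n^m is at most
    tr M^(km), the sum of the (km)-th powers of the eigenvalues of M, so
    n^m <= e rho^(km) for all m; thus n <= rho^k.  Counting preimages of one
    point avoids the problem that J_l may cover an edge from both ends
    without any subinterval of J_l mapping onto that edge. *)
Require Import Defs.
From mathcomp Require Import all_boot all_order all_algebra.
From mathcomp Require Import complex.
From mathcomp Require Import all_classical all_reals all_analysis.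
From mathcomp Require Import ring lra.
Import numFieldNormedType.Exports.
Set Implicit Arguments.
Unset Strict Implicit.
Unset Printing Implicit Defensive.
Import Order.TTheory GRing.Theory Num.Theory.
Local Open Scope classical_set_scope.
Local Open Scope ring_scope.

(** * Traces of matrix powers and the spectral radius *)

Lemma trigmx_mul (F : comNzRingType) (n : nat) (A B : 'M[F]_n) :
  is_trig_mx A -> is_trig_mx B ->
  is_trig_mx (A *m B) /\ forall i, (A *m B) i i = A i i * B i i.
Proof.
move=> /is_trig_mxP tA /is_trig_mxP tB; split=> [|i].
  apply/is_trig_mxP => i j ij; rewrite mxE big1// => l _.
  have [il|li] := ltnP i l; first by rewrite tA// mul0r.
  by rewrite tB ?mulr0// (leq_ltn_trans li).
rewrite mxE (bigD1 i)//= big1 ?addr0// => l li.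
have [il|il|/val_inj il] := ltngtP i l; last by rewrite il eqxx in li.
  by rewrite tA// mul0r.
by rewrite tB// mulr0.
Qed.

Lemma trigmx_exp (F : comNzRingType) (n : nat) (A : 'M[F]_n) (N : nat) :
  is_trig_mx A ->
  is_trig_mx (A ^+ N) /\ forall i, (A ^+ N) i i = A i i ^+ N.
Proof.
move=> tA; elim: N => [|m [IHt IHd]].
  split=> [|i]; first exact: scalar_mx_is_trig.
  by rewrite !expr0 mxE eqxx.
have [tm dm] := trigmx_mul tA IHt; rewrite exprS; split=> // i.
by rewrite dm IHd exprS.
Qed.

Lemma ReE_norm (R : rcfType) (z : R[i]) : (complex.Re `|z|)%:C%C = `|z|.
Proof. by rewrite RRe_real// normr_real. Qed.

Lemma Re_norm_ge0 (R : rcfType) (z : R[i]) : 0 <= complex.Re `|z|.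
Proof. by rewrite -lecR ReE_norm normr_ge0. Qed.

(** Over the complex numbers a unitary conjugation makes [A] triangular, so the trace of [A ^+ N] is
    the sum of the N-th powers of the diagonal entries, which are eigenvalues of [A]. *)
Lemma mxtrace_exp_le (R : rcfType) (n : nat) (A : 'M[R[i]]_n) (r : R)
    (N : nat) :
  (forall z, eigenvalue A z -> complex.Re `|z| <= r) ->
  complex.Re `|\tr (A ^+ N)| <= r ^+ N *+ n.
Proof.
case: n A => [|n] A hA; first by rewrite /mxtrace big_ord0 normr0 mulr0n.
have [P /unitarymx_unit Pu] := Schur A isT.
rewrite /similar_to; set T := conjmx P A => tT.
have defA : A = invmx P *m T *m P.
  by rewrite /T conjumx// !mulmxA mulVmx// mul1mx mulmxKV.
have [tTN dTN] := trigmx_exp N tT.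
have -> : \tr (A ^+ N) = \sum_i T i i ^+ N.
  have -> : A ^+ N = invmx P *m T ^+ N *m P.
    rewrite defA; elim: N {tTN dTN} => [|m IH].
      by rewrite !expr0 mulmx1 mulVmx.
    by rewrite exprS IH exprS -!mulmxE !mulmxA mulmxK.
  rewrite mxtrace_mulC mulmxA mulmxV// mul1mx.
  by apply: eq_bigr => i _; rewrite dTN.
have eT i : eigenvalue A (T i i).
  have Pf : row_free P by rewrite row_free_unit.
  apply: (eigenvalue_conjmx (stablemx_unit _ Pu) Pf).
  rewrite -topredE /= eigenvalue_root_char char_poly_trig//.
  by rewrite (bigD1 i)//= rootM root_XsubC eqxx.
rewrite -lecR ReE_norm (le_trans (ler_norm_sum _ _ _))//.
rewrite rmorphMn/= -[in leRHS](card_ord n.+1) -sumr_const ler_sum// => i _.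
rewrite normrX rmorphXn/=; have := hA _ (eT i).
rewrite -lecR ReE_norm => Tr.
(* The eigenvalue at hand forces [r] to be nonnegative. *)
have r0 : 0 <= r%:C%C := le_trans (normr_ge0 _) Tr.
by apply: lerXn2r; rewrite ?nnegrE ?normr_ge0.
Qed.

(** A [sup] is an upper bound only for a bounded set; here the sum of the moduli of all roots of the
    characteristic polynomial bounds the set. *)
Lemma eigenvalue_spectral_radius (R : realType) (n : nat) (A : 'M[R]_n)
    (z : R[i]) :
  eigenvalue (map_mx (real_complex R) A) z ->
  complex.Re `|z| <= spectral_radius A.
Proof.
move=> Az; apply: ub_le_sup; last by exists z.
set B := map_mx _ _ in Az *.
have [s defs] := closed_field_poly_normal (char_poly B).
exists (\sum_(w <- s) complex.Re `|w|) => _ [w] /= + <-.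
rewrite eigenvalue_root_char defs.
rewrite rootZ ?lead_coef_eq0 ?monic_neq0 ?char_poly_monic//.
rewrite root_prod_XsubC => ws.
by rewrite (big_rem w)//= lerDl sumr_ge0// => v _; exact: Re_norm_ge0.
Qed.

Lemma spectral_radius_ge0 (R : realType) (n : nat) (A : 'M[R]_n) :
  0 <= spectral_radius A.
Proof.
have [[z Az]|noev] :=
    pselect (exists z, eigenvalue (map_mx (real_complex R) A) z).
  exact: le_trans (Re_norm_ge0 z) (eigenvalue_spectral_radius Az).
(* Without eigenvalues the set is empty, and its [sup] is 0 by convention. *)
rewrite /spectral_radius; set S := (X in sup X).
have -> : S = set0; last by rewrite sup0.
by apply/seteqP; split=> // w [z Az _]; apply: noev; exists z.
Qed.

(** If q > 1, Bernoulli's inequality makes q^m grow at least linearly in m, past every c. *)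
Lemma bounded_exp_le1 (R : archiRealFieldType) (q c : R) :
  (forall m, q ^+ m <= c) -> q <= 1.
Proof.
move=> qc; rewrite leNgt; apply/negP => q1.
have bern m : 1 + (q - 1) *+ m <= q ^+ m.
  elim: m => [|m IH]; first by rewrite mulr0n addr0 expr0.
  rewrite exprS mulrSr.
  have q1m : 1 <= q ^+ m by rewrite exprn_ege1// ltW.
  nra.
have := archi_boundP (normr_ge0 (c / (q - 1))); set m := Num.bound _ => cm.
have := le_trans (bern m) (qc m); rewrite leNgt => /negP; apply.
rewrite -mulr_natr -ltrBlDl (@le_lt_trans _ _ c)//; first lra.
by rewrite mulrC -ltr_pdivrMr ?subr_gt0// (le_lt_trans (ler_norm _)).
Qed.

(** Entries being nonnegative, a diagonal entry is at most the trace, hence at most e rho^(km). So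
    (n / rho^k)^m <= e for every m, and the ratio is at most 1. *)
Lemma spectral_radius_lower_bound (R : realType) (e : nat) (A : 'M[R]_e)
    (k n : nat) (i : 'I_e) :
  (forall i j, 0 <= A i j) -> (0 < k)%N -> (0 < n)%N ->
  (forall m, (n ^ m)%:R <= (A ^+ (k * m)) i i) ->
  n%:R <= spectral_radius A ^+ k.
Proof.
move=> A0 k0 n0 nA; set rho := spectral_radius A.
have A0N N : forall i j, 0 <= (A ^+ N) i j.
  elim: N => [|N IH] a b; first by rewrite expr0 mxE ler0n.
  by rewrite exprS -mulmxE mxE sumr_ge0// => l _; rewrite mulr_ge0.
have bound m : (n ^ m)%:R <= (rho ^+ k) ^+ m *+ e.
  apply: (le_trans (nA m)).
  have : (A ^+ (k * m)) i i <= \tr (A ^+ (k * m)).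
    by rewrite /mxtrace (bigD1 i)//= lerDl sumr_ge0.
  move/le_trans; apply.
  have := mxtrace_exp_le (k * m) (@eigenvalue_spectral_radius _ _ A).
  have -> : map_mx (real_complex R) A ^+ (k * m) =
      map_mx (real_complex R) (A ^+ (k * m)).
    elim: (k * m)%N => [|N IH]; first by rewrite !expr0 map_mx1.
    by rewrite !exprS IH -mulmxE -map_mxM.
  rewrite trace_map_mx -exprM; apply: le_trans.
  rewrite -lecR ReE_norm; apply: le_trans (normc_ge_Re _).
  rewrite lecR ler_norm//.
(* The case m = 1 yields rho^k > 0, which permits the division. *)
have := bound 1%N; rewrite expn1 expr1 => bound1.
have rhok0 : 0 < rho ^+ k.
  have : 0 < rho ^+ k *+ e by apply: lt_le_trans bound1; rewrite ltr0n.
  by rewrite pmulrn_lgt0// (leq_trans _ (ltn_ord i)).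
rewrite -[leRHS]mul1r -ler_pdivrMr//.
apply: (@bounded_exp_le1 _ _ e%:R) => m.
rewrite expr_div_n ler_pdivrMr ?(exprn_gt0 m rhok0)//.
by rewrite -natrX mulr_natl.
Qed.

(** * Homeomorphisms between subsets, with their inverses *)

Lemma within_continuous_comp_to (T U V : topologicalType) (A : set T)
    (B : set U) (f : T -> U) (g : U -> V) :
  set_fun A B f -> {within A, continuous f} -> {within B, continuous g} ->
  {within A, continuous (g \o f)}.
Proof.
move=> fAB /continuousP cf /continuousP cg; apply/continuousP => O oO.
have /open_subspaceP[W oW WB] := cg O oO.
have /open_subspaceP[W' oW' W'A] := cf W oW.
apply/open_subspaceP; exists W' => //.
rewrite W'A; apply/seteqP; split=> x [fx Ax]; split=> //.
  have : (W `&` B) (f x) by split=> //; exact: fAB.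
  by rewrite WB => -[].
have : (from_subspace B g @^-1` O `&` B) (f x) by split=> //; exact: fAB.
by rewrite -WB => -[].
Qed.

(** A symmetric form of [homeo_onto] that names the inverse, so that homeomorphisms are easily
    inverted, composed and restricted. *)
Definition inverse_homeos (T U : topologicalType) (A : set T) (B : set U)
    (f : T -> U) (g : U -> T) : Prop :=
  [/\ set_fun A B f, set_fun B A g,
      forall x, A x -> g (f x) = x, forall y, B y -> f (g y) = y &
      {within A, continuous f} /\ {within B, continuous g}].

Lemma homeo_ontoP (T U : topologicalType) (A : set T) (B : set U)
    (f : T -> U) :
  homeo_onto A B f <-> exists g, inverse_homeos A B f g.
Proof.
split=> [[[fAB fI fS] cf [g cg gK]]|[g [fAB gBA gK fK [cf cg]]]].
  by exists g; split=> // y /fS[x Ax <-]; rewrite gK.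
split=> //; last by exists g.
split=> // [x y /set_mem Ax /set_mem Ay fxy|y By].
  by rewrite -(gK x Ax) fxy gK.
by exists (g y); [exact: gBA | exact: fK].
Qed.

Lemma inverse_homeos_sym (T U : topologicalType) (A : set T) (B : set U)
    (f : T -> U) (g : U -> T) :
  inverse_homeos A B f g -> inverse_homeos B A g f.
Proof. by case=> ? ? ? ? []. Qed.

Lemma inverse_homeos_comp (T U V : topologicalType) (A : set T) (B : set U)
    (C : set V) (f : T -> U) (f' : U -> T) (g : U -> V) (g' : V -> U) :
  inverse_homeos A B f f' -> inverse_homeos B C g g' ->
  inverse_homeos A C (g \o f) (f' \o g').
Proof.
move=> [fAB f'BA f'K fK [cf cf']] [gBC g'CB g'K gK [cg cg']]; split.
- by move=> x /fAB /gBC.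
- by move=> x /g'CB /f'BA.
- by move=> x Ax /=; rewrite g'K ?f'K//; exact: fAB.
- by move=> x Cx /=; rewrite fK ?gK//; exact: g'CB.
- by split; [exact: within_continuous_comp_to cf cg
            |exact: within_continuous_comp_to cg' cf'].
Qed.

Lemma inverse_homeos_sub (T U : topologicalType) (A A' : set T) (B : set U)
    (f : T -> U) (g : U -> T) :
  A' `<=` A -> inverse_homeos A B f g -> inverse_homeos A' (f @` A') f g.
Proof.
move=> A'A [fAB gBA gK fK [cf cg]].
have fA'B : f @` A' `<=` B by move=> _ [x /A'A/fAB + <-].
split.
- by move=> x A'x; exists x.
- by move=> _ [x A'x <-]; rewrite /= gK//; exact: A'A.
- by move=> x /A'A; exact: gK.
- by move=> y /fA'B; exact: fK.
- by split; [exact: continuous_subspaceW cf|exact: continuous_subspaceW cg].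
Qed.

Lemma inverse_homeos_eq (T U : topologicalType) (A : set T) (B : set U)
    (f f' : T -> U) (g : U -> T) :
  (forall x, A x -> f x = f' x) ->
  inverse_homeos A B f g -> inverse_homeos A B f' g.
Proof.
move=> ff' [fAB gBA gK fK [cf cg]]; split=> //.
- by move=> x Ax; rewrite /= -ff'//; exact: fAB.
- by move=> x Ax; rewrite -ff'// gK.
- by move=> y By; rewrite -ff' ?fK//; exact: gBA.
- split=> //; apply: subspace_eq_continuous cf => x /set_mem; exact: ff'.
Qed.

Lemma inverse_homeos_affine (R : realType) (a b : R) : a < b ->
  inverse_homeos (`[0, 1]%classic : set R) (`[a, b]%classic : set R)
    (fun t : R => a + t * (b - a))
    (fun t : R => (t - a) / (b - a)).
Proof.
move=> ab; have ba0 : b - a != 0 by rewrite subr_eq0 gt_eqF.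
have ba_gt0 : 0 < b - a by rewrite subr_gt0.
split.
- move=> t; rewrite /= !in_itv/= => /andP[t0 t1].
  by apply/andP; split; nra.
- move=> t; rewrite /= !in_itv/= => /andP[ta tb].
  by rewrite divr_ge0 ?subr_ge0 ?(ltW ab)//= ler_pdivrMr// mul1r lerB.
- by move=> t _; field.
- by move=> t _; field.
- split; apply: continuous_subspaceT => t.
    by apply: cvgD; [exact: cvg_cst|apply: cvgM; [exact: cvg_id|exact: cvg_cst]].
  by apply: cvgM; [apply: cvgB; [exact: cvg_id|]|]; exact: cvg_cst.
Qed.

Lemma inverse_homeos_flip (R : realType) :
  inverse_homeos (`[0, 1]%classic : set R) (`[0, 1]%classic : set R)
    (fun t : R => 1 - t) (fun t : R => 1 - t).
Proof.
have c : continuous (fun t : R => 1 - t).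
  by move=> t; apply: cvgB; [exact: cvg_cst|exact: cvg_id].
split=> [t|t|t _|t _|]; rewrite /= ?in_itv/=; try lra.
by split; exact: continuous_subspaceT.
Qed.

(** A continuous injection on an interval is monotone, so the ends go to the minimum and maximum of
    the image. *)
Lemma inverse_homeos_endpoints (R : realType) (a b : R) (f g : R -> R) :
  a <= b ->
  inverse_homeos (`[a, b]%classic : set R) (`[0, 1]%classic : set R) f g ->
  [/\ f a = 0 \/ f a = 1 & f b = 0 \/ f b = 1].
Proof.
move=> ab [fab gab gK fK [cf _]].
have finj : {in `[a, b] &, injective f}.
  by move=> x y xab yab fxy; rewrite -(gK x xab) fxy gK.
have aI : a \in `[a, b] by rewrite bound_itvE.
have bI : b \in `[a, b] by rewrite bound_itvE.
have I0 : (0 : R) \in `[0, 1] by rewrite bound_itvE.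
have I1 : (1 : R) \in `[0, 1] by rewrite bound_itvE.
have := fab _ aI; have := fab _ bI; have := gab _ I0; have := gab _ I1.
have := fK _ I0; have := fK _ I1.
set c := g 0; set d := g 1; move=> fd fc dI cI.
rewrite /= !in_itv/= => /andP[fb0 fb1] /andP[fa0 fa1].
move: cI dI; rewrite /= !in_itv/= => cI dI.
have /andP[ac cb] := cI; have /andP[ad db] := dI.
case: (itv_continuous_inj_mono cf finj) => [/ltW_homo_in|/ltW_nhomo_in] fm.
  split; [left|right]; apply/le_anti; rewrite ?fa0 ?fb1 ?andbT /=.
    by rewrite -fc; exact: fm.
  by rewrite -fd; exact: fm.
split; [right|left]; apply/le_anti; rewrite ?fb0 ?fa1 ?andbT /=.
  by rewrite -fd; exact: fm.
by rewrite -fc; exact: fm.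
Qed.

(** * Laps of a linearized map and entries of the Markov matrix *)

Section LinearMaps.
Variables (R : realType) (G : graph R).
Implicit Types (L : G -> G) (i j : 'I_(nedges G)) (d : oedge G).

Lemma ochart_inverse d : exists g : G -> R,
  inverse_homeos (`[0, 1]%classic : set R) (edge G d.1) (ochart d) g.
Proof.
have /homeo_ontoP[g ig] := chart_homeo d.1.
rewrite /ochart; case: d.2; last by exists g.
by eexists; apply: inverse_homeos_comp ig; exact: inverse_homeos_flip.
Qed.

Lemma nonvertex_edge_inj i j (x : G) :
  edge G i x -> edge G j x -> ~ vertex G x -> i = j.
Proof.
move=> ix jx vx; have [//|ij] := eqVneq i j; exfalso.
have : (edge G i `&` edge G j) x by [].
case: (edge_meet ij) => [->//|[v vv ->] /= xv|[v [w [vv vw _ ->]]] /=].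
  by apply: vx; rewrite xv.
by case=> xv; apply: vx; rewrite xv.
Qed.

(** A lap is a piece of E_j on which [L] runs along one edge of [p]. There [L] is the composite of
    the inverse chart of E_j, an affine rescaling to [0,1] and the oriented chart of that edge. *)
Lemma lap_homeo L j (p : seq (oedge G)) (s : 'I_(size p)) :
  constant_speed_along p (L \o chart G j) ->
  homeo_onto (chart G j @` `[s%:R / (size p)%:R, s.+1%:R / (size p)%:R])
    (edge G (tnth (in_tuple p) s).1) L.
Proof.
move=> Lp; set m := (size p)%:R; set a := s%:R / m; set b := s.+1%:R / m.
have m0 : 0 < m :> R by rewrite ltr0n (leq_ltn_trans _ (ltn_ord s)).
have ba : b - a = m^-1 by rewrite /a /b -addn1 natrD; field; rewrite gt_eqF.
have ab : a < b by rewrite -subr_gt0 ba invr_gt0.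
have ab01 : `[a, b]%classic `<=` (`[0, 1]%classic : set R).
  move=> t; rewrite /= !in_itv/= => /andP[at_ tb].
  rewrite (le_trans _ at_) ?divr_ge0 ?ler0n ?(ltW m0)//= (le_trans tb)//.
  by rewrite ler_pdivrMr// mul1r ler_nat.
have /homeo_ontoP[cj' icj] := chart_homeo j.
have [d' id] := ochart_inverse (tnth (in_tuple p) s).
apply/homeo_ontoP; eexists; apply: inverse_homeos_eq; last first.
  apply: inverse_homeos_comp id.
  apply: inverse_homeos_comp (inverse_homeos_sym (inverse_homeos_affine ab)).
  exact: inverse_homeos_sym (inverse_homeos_sub ab01 icj).
move=> _ [t tab <-] /=; have [_ _ cjK _ _] := icj.
rewrite cjK; last exact: ab01.
rewrite -Lp/=; last first.
  by have [_ + _ _ _] := inverse_homeos_affine ab; apply.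
rewrite ba invrK /a; congr (L (chart _ _ _)); field; rewrite gt_eqF//.
Qed.

(** Induction on m locates t m in a unit interval; t = 1 gets s = m - 1 and u = 1. *)
Lemma lap_decomposition (m : nat) (t : R) : (0 < m)%N -> 0 <= t <= 1 ->
  exists (s : 'I_m) (u : R), 0 <= u <= 1 /\ t = (s%:R + u) / m%:R.
Proof.
move=> m0 /andP[t0 t1]; have mR0 : 0 < m%:R :> R by rewrite ltr0n.
suff [s [u [u01 tm]]] :
    exists (s : 'I_m) (u : R), 0 <= u <= 1 /\ t * m%:R = s%:R + u.
  by exists s, u; split=> //; rewrite -tm mulfK// gt_eqF.
have : t * m%:R <= m%:R by rewrite ler_piMl// ltW.
have : 0 <= t * m%:R by rewrite mulr_ge0// ltW.
move: (t * m%:R) => {t0 t1 mR0} {}t t0.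
elim: m m0 => [//|m IH] _ tm.
have [tm'|mt] := leP t m%:R; last first.
  exists ord_max, (t - m%:R); rewrite subr_ge0 (ltW mt) lerBlDl natr1 tm.
  by rewrite addrC subrK.
case: m IH tm tm' => [|m] IH tm tm'.
  by exists ord0, t; rewrite t0 add0r.
have [s [u su]] := IH isT tm'.
by exists (widen_ord (leqnSn _) s), u.
Qed.

(** Finiteness makes [fset_set] count correctly in [markov]. The ends of a covering interval map to
    ends of E_i, hence to vertices, and [L] sends only the break points s/m of E_j to vertices, m
    being the length of [p]. *)
Lemma covering_intervals_finite L i j (p : seq (oedge G)) :
  (0 < size p)%N -> constant_speed_along p (L \o chart G j) ->
  finite_set (covering_intervals L i j).
Proof.
move=> p0 Lp.
have m0 : (size p)%:R != 0 :> R by rewrite pnatr_eq0 -lt0n.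
pose S := [set (s%:R / (size p)%:R : R) | s in `I_(size p).+1].
have S_fin : finite_set S by apply: finite_image; exact: finite_II.
have LS t : 0 <= t <= 1 -> vertex G (L (chart G j t)) -> S t.
  move=> /(lap_decomposition p0)[s [u [u01 ->]]].
  rewrite [L _](Lp s u u01) /ochart => vu.
  have [->|un0] := eqVneq u 0.
    by exists s; rewrite ?addr0//= ltnW// ltnS.
  have [->|un1] := eqVneq u 1.
    by exists s.+1; rewrite ?natr1//= ltnS.
  exfalso; move: vu; apply: chart_interior.
  have /andP[u0 u1] : 0 < u < 1.
    by rewrite !lt_neqAle eq_sym un0 un1.
  by case: ifP => _; apply/andP; split; lra.
apply: (@sub_finite_set _ _ (S `*` S)); last exact: finite_setX.
move=> [a b] [/= a0 ab b1 /homeo_ontoP[L' iL]].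
have ab01 : `[a, b]%classic `<=` (`[0, 1]%classic : set R).
  move=> t; rewrite /= !in_itv/= => /andP[at_ tb].
  by rewrite (le_trans a0)//= (le_trans tb).
have /homeo_ontoP[cj' icj] := chart_homeo j.
have /homeo_ontoP[ci' ici] := chart_homeo i.
(* In charts, [L] is a homeomorphism of [a,b] onto [0,1], so a and b go to 0 or 1. *)
have iab := inverse_homeos_comp (inverse_homeos_comp
  (inverse_homeos_sub ab01 icj) iL) (inverse_homeos_sym ici).
have [fa fb] := inverse_homeos_endpoints (ltW ab) iab.
have vL t : `[a, b]%classic t -> ci' (L (chart G j t)) = 0 \/
    ci' (L (chart G j t)) = 1 -> vertex G (L (chart G j t)).
  move=> tab; have [Lfun _ _ _ _] := iL; have [_ _ _ ciK _] := ici.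
  have iLt : edge G i (L (chart G j t)) by apply: Lfun; exists t.
  by rewrite -[X in vertex G X](ciK _ iLt) => -[->|->];
    have [] := chart_vertex i.
split; apply: LS; first by rewrite a0 (le_trans (ltW ab)).
- by apply: vL => //; rewrite /= bound_itvE ltW.
- by rewrite b1 (le_trans a0)// ltW.
- by apply: vL => //; rewrite /= bound_itvE ltW.
Qed.

(** Each lap over E_i is a covering interval, and its left end determines the lap. *)
Lemma le_markov L i j (p : seq (oedge G)) :
  (0 < size p)%N -> constant_speed_along p (L \o chart G j) ->
  #|[pred s : 'I_(size p) | (tnth (in_tuple p) s).1 == i]|%:R <=
  Defs.markov L i j.
Proof.
move=> p0 Lp; have m0 : 0 < (size p)%:R :> R by rewrite ltr0n.
have cfin := covering_intervals_finite i p0 Lp.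
pose lap (s : 'I_(size p)) : R * R :=
  (s%:R / (size p)%:R, s.+1%:R / (size p)%:R).
rewrite mxE ler_nat cardE -(size_map lap).
apply: uniq_leq_size => [|_ /mapP[s + ->]].
  rewrite map_inj_uniq ?enum_uniq// => s s' [/mulIf + _].
  by rewrite invr_eq0 gt_eqF// => /(_ isT)/eqP; rewrite eqr_nat => /eqP/val_inj.
rewrite mem_enum inE => /eqP si; rewrite in_fset_set//; apply/mem_set.
split=> /=; last by rewrite -si; exact: lap_homeo.
- by rewrite divr_ge0// ltW.
- by rewrite ltr_pM2r ?invr_gt0// ltr_nat.
- by rewrite ler_pdivrMr// mul1r ler_nat.
Qed.

(** Each lap over E_i carries exactly one preimage of x. Not being a vertex, x lies on no other
    edge, so no other lap reaches it. *)
Lemma preimages_le L i j (p : seq (oedge G)) (x : G) :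
  (0 < size p)%N -> constant_speed_along p (L \o chart G j) ->
  edge G i x -> ~ vertex G x ->
  exists ys : seq G, (size ys)%:R <= Defs.markov L i j /\
    forall y, edge G j y -> L y = x -> y \in ys.
Proof.
move=> p0 Lp ix vx.
have [g gK] : exists g : oedge G -> G -> R, forall d u,
    0 <= u <= 1 -> g d (ochart d u) = u.
  have /choice[g ig] := ochart_inverse.
  by exists g => d u u01; have [_ _ + _ _] := ig d; apply; rewrite /= in_itv.
pose A := [pred s : 'I_(size p) | (tnth (in_tuple p) s).1 == i].
exists [seq chart G j ((s%:R + g (tnth (in_tuple p) s) x) / (size p)%:R)
  | s : 'I_(size p) <- enum A].
split; first by rewrite size_map -cardE; exact: le_markov.
move=> y [t /=]; rewrite in_itv/= => t01 <-.
have [s [u [u01 ->]]] := lap_decomposition p0 t01.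
rewrite [L _](Lp s u u01) => sx; apply/mapP; exists s; last first.
  by rewrite -sx gK.
rewrite mem_enum inE; apply/eqP; apply: nonvertex_edge_inj vx => //.
rewrite -sx /ochart; eexists; last reflexivity.
by rewrite /= in_itv/=; case: ifP => _; lra.
Qed.

(** Splitting off the first step from y to L y, which lies in some E_l, bounds the count by the sum
    over l of (M^m)_(i,l) M_(l,j), an entry of M^(m+1). *)
Lemma iter_preimages_le L (p : 'I_(nedges G) -> seq (oedge G)) (m : nat)
    i j (x : G) :
  (forall v, vertex G v -> vertex G (L v)) ->
  (forall j, (0 < size (p j))%N) ->
  (forall j, constant_speed_along (p j) (L \o chart G j)) ->
  edge G i x -> ~ vertex G x ->
  exists ys : seq G, (size ys)%:R <= (Defs.markov L ^+ m) i j /\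
    forall y, edge G j y -> iter m L y = x -> y \in ys.
Proof.
move=> vL p0 Lp ix vx; elim: m j => [|m IH] j.
  rewrite expr0 mxE; have [<-|ij] := eqVneq i j.
    by exists [:: x]; split=> // y _ /= ->; rewrite mem_head.
  exists [::]; split=> // y jy /= yx; move/eqP: ij; case.
  by apply: nonvertex_edge_inj vx => //; rewrite -yx.
have M0 k l : 0 <= Defs.markov L k l by rewrite mxE.
have /choice[z zP] := IH.
(* Choice requires a list for every pair (l, w); where w is a vertex or off E_l, the empty list
   serves. *)
have W (lz : 'I_(nedges G) * G) : exists ys : seq G,
    (size ys)%:R <= Defs.markov L lz.1 j /\
    (edge G lz.1 lz.2 -> ~ vertex G lz.2 ->
     forall y, edge G j y -> L y = lz.2 -> y \in ys).
  case: lz => l w /=; have [[lw vw]|nlw] :=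
      pselect (edge G l w /\ ~ vertex G w).
    by have [ys [? ?]] := preimages_le (p0 j) (Lp j) lw vw; exists ys.
  by exists [::]; split=> // lw vw; case: nlw.
have /choice[ys ysP] := W.
(* [z l] contains every w in E_l with L^m w = x; for w a non-vertex of E_l, [ys (l, w)] contains
   every point of E_j that [L] maps to w. *)
exists (flatten [seq flatten [seq ys (l, w) | w <- z l]
  | l <- enum 'I_(nedges G)]).
split.
  rewrite exprSr -mulmxE mxE size_flatten /shape -map_comp sumnE big_map.
  rewrite big_enum/= natr_sum ler_sum// => l _.
  rewrite size_flatten /shape -map_comp sumnE big_map natr_sum.
  rewrite (@le_trans _ _ (\sum_(w <- z l) Defs.markov L l j))//.
    by rewrite ler_sum// => w _; have [] := ysP (l, w).
  rewrite big_const_seq count_predT iter_addr addr0 -mulr_natl.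
  by rewrite ler_wpM2r//; have [] := zP l.
move=> y jy; rewrite iterSr => Lyx.
(* Otherwise x, an iterate of the vertex L y, would be a vertex. *)
have vLy : ~ vertex G (L y).
  move=> vLy; apply: vx; rewrite -Lyx.
  by elim: (m) => //= n; exact: vL.
have [l lLy] : exists l, edge G l (L y).
  have : [set: G] (L y) by [].
  by rewrite -(graph_cover G) => -[//|[l _ ?]]; exists l.
apply/flattenP; exists (flatten [seq ys (l, w) | w <- z l]).
  by apply/mapP; exists l => //; rewrite mem_enum.
apply/flattenP; exists (ys (l, L y)).
  by apply/mapP; exists (L y) => //; have [_ /(_ _ lLy Lyx)] := zP l.
by have [_ /(_ lLy vLy y jy erefl)] := ysP (l, L y).
Qed.

End LinearMaps.

(** * Preimages in a horseshoe and the choice of a generic point *)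

(* The J_l may overlap in D; the orbit condition on x keeps its successive
   preimages out of D, so those taken in different J_l are distinct. *)
Lemma horseshoe_preimages (T : eqType) (n : nat) (g : T -> T)
    (J : 'I_n -> set T) (D : set T) (m : nat) (x : T) :
  (forall l l', l != l' -> J l `&` J l' `<=` D) ->
  \bigcup_l J l `<=` \bigcap_l (g @` J l) ->
  (\bigcup_l J l) x -> (forall r, (r <= m)%N -> ~ (iter r g @` D) x) ->
  exists ys : seq T, [/\ uniq ys, size ys = (n ^ m)%N &
    forall y, y \in ys -> (\bigcup_l J l) y /\ iter m g y = x].
Proof.
move=> JD Jg; elim: m x => [|m IH] x Jx xD.
  by exists [:: x]; split=> // y; rewrite inE => /eqP ->.
have /choice[w wP] : forall l, exists w, J l w /\ g w = x.
  by move=> l; have [w Jw <-] := Jg x Jx l I; exists w.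
have /choice[ys ysP] : forall l, exists ys : seq T,
    [/\ uniq ys, size ys = (n ^ m)%N &
      forall y, y \in ys -> (\bigcup_l J l) y /\ iter m g y = w l].
  move=> l; have [Jw gw] := wP l; apply: IH; first by exists l.
  (* If w l = g^r d then x = g^(r+1) d, so the orbit condition passes to [w l] with m lowered by
     one. *)
  move=> r rm [d Dd rd]; apply: (xD r.+1) => //; exists d => //.
  by rewrite iterS rd.
(* For l and l' distinct, a common value would lie in D, with x as its image under g. *)
have w_inj l l' : w l = w l' -> l = l'.
  move=> ww; have [//|ll'] := eqVneq l l'; exfalso.
  have [Jw gw] := wP l; have [Jw' _] := wP l'.
  apply: (xD 1%N) => //; exists (w l) => //.
  by apply: JD ll' _ _; split; rewrite // ww.
exists (flatten [seq ys l | l <- enum 'I_n]); split.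
(* A common member y of two lists would give w l = g^m y = w l'. *)
- have := enum_uniq 'I_n; elim: (enum _) => //= l s IHs /andP[ls us].
  rewrite cat_uniq IHs// andbT; have [-> _ yl] := ysP l.
  apply/hasPn => y /flattenP[_ /mapP[l' l's ->] yl']; apply/negP => yin.
  have [_ yw] := yl _ yin; have [_ _ /(_ _ yl')[_ yw']] := ysP l'.
  by move: ls; rewrite (w_inj l l') ?l's// -yw -yw'.
- rewrite size_flatten /shape -map_comp sumnE big_map big_enum/=.
  rewrite (eq_bigr (fun=> (n ^ m)%N)) => [|l _]; last by have [] := ysP l.
  by rewrite sum_nat_const card_ord expnS.
- move=> y /flattenP[_ /mapP[l _ ->] yl]; have [_ _ /(_ _ yl)[Jy yw]] := ysP l.
  by split=> //; rewrite iterS yw; have [] := wP l.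
Qed.

(** Pigeonhole: take one more point of (a,b) than a list of C has entries; their images are
    distinct, so one misses C. *)
Lemma exists_notin_finite (R : realFieldType) (T : choiceType) (C : set T)
    (h : R -> T) (a b : R) : finite_set C -> a < b ->
  (forall s t, a < s < b -> a < t < b -> h s = h t -> s = t) ->
  exists t, a < t < b /\ ~ C (h t).
Proof.
move=> /finite_seqP[s ->] ab h_inj; apply: contrapT => /forallNP hC.
have {}hC t : a < t < b -> h t \in s.
  by move=> abt; have [//|ts] := boolP (h t \in s); case: (hC t); split=> //;
    apply/negP.
(* With this N all fractions (q+1)/N, for q up to [size s], lie strictly between 0 and 1. *)
pose N := (size s).+2; have N0 : 0 < N%:R :> R by rewrite ltr0n.
pose t (q : 'I_(size s).+1) : R := a + (b - a) * (q.+1%:R / N%:R).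
have tab q : a < t q < b.
  have q0 : 0 < q.+1%:R / N%:R :> R by rewrite divr_gt0.
  have q1 : q.+1%:R / N%:R < 1 :> R.
    by rewrite ltr_pdivrMr// mul1r ltr_nat ltnS.
  by rewrite /t; apply/andP; split; nra.
have t_inj : injective (h \o t).
  move=> q q' /= /(h_inj _ _ (tab q) (tab q'))/addrI/mulfI.
  rewrite subr_eq0 gt_eqF// => /(_ isT)/mulIf; rewrite invr_eq0 gt_eqF//.
  by move=> /(_ isT)/eqP; rewrite eqr_nat => /eqP[/val_inj].
have : (size [seq (h \o t) q | q <- enum 'I_(size s).+1] <= size s)%N.
  apply: uniq_leq_size; first by rewrite map_inj_uniq// enum_uniq.
  by move=> _ /mapP[q _ ->]; exact: hC.
by rewrite size_map size_enum_ord ltnn.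
Qed.

(** * The entropy bound *)

Theorem theorem8 (R : realType) (G : graph R) (f L : G -> G) (k n : nat)
    (hf : vertex_map f) (hL : linearization f L)
    (hk : (0 < k)%N) (hn : (0 < n)%N)
    (hE : exists E : 'I_(nedges G), horseshoe n (iter k L) E) :
  k%:R^-1 * ln (n%:R : R) <= entropy L.
Proof.
have [E [a [b [ab01 ab_disj]]]] := hE.
set J := fun l : 'I_n => chart G E @` `[a l, b l] => /= hJ.
have [hLf /choice[p hp]] := hL; have [_ [ff f_inj _]] := hf.
have vL v : vertex G v -> vertex G (L v).
  by move=> vv; rewrite hLf//; exact: ff.
have chart_inj s t : 0 <= s <= 1 -> 0 <= t <= 1 ->
    chart G E s = chart G E t -> s = t.
  have [[_ cI _] _ _] := chart_homeo E.
  by move=> s01 t01; apply: cI; rewrite inE/= in_itv.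
(* An empty path would identify the images of the two ends of the edge, but [f] is injective on
   vertices. *)
have p0 j : (0 < size (p j))%N.
  have [pj _ _ _] := hp j; case: (p j) pj => //= f01.
  have [v0 v1] := chart_vertex j.
  have c01 := f_inj _ _ (mem_set v0) (mem_set v1) f01.
  have [[_ cI _] _ _] := chart_homeo j.
  have : (0 : R) = 1 by apply: cI c01; rewrite inE/= bound_itvE.
  by move/eqP; rewrite eq_sym oner_eq0.
have Lp j : constant_speed_along (p j) (L \o chart G j) by have [] := hp j.
(* The ends of the J_l: a shared point that is no end would lie in two of the disjoint open
   intervals. *)
pose D := (chart G E \o a) @` [set: 'I_n] `|` (chart G E \o b) @` [set: 'I_n].
have D_fin : finite_set D.
  by rewrite finite_setU; split; apply: finite_image; exact: finite_finset.
have JD l l' : l != l' -> J l `&` J l' `<=` D.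
  move=> ll' x [[t tl <-] [t' tl' tt']].
  have [al abl bl] := ab01 l; have [al' abl' bl'] := ab01 l'.
  move: tl tl'; rewrite /= !in_itv/= => tl tl'.
  have {}tt' : t' = t by apply: chart_inj tt'; lra.
  rewrite {t'}tt' in tl'.
  have [->|ta] := eqVneq t (a l); first by left; exists l.
  have [->|tb] := eqVneq t (b l); first by right; exists l.
  have [->|ta'] := eqVneq t (a l'); first by left; exists l'.
  have [->|tb'] := eqVneq t (b l'); first by right; exists l'.
  move/eqP: ll'; case; apply: ab_disj => //; exists t.
  by split; rewrite /= in_itv/= !lt_neqAle eq_sym ?ta ?tb ?ta' ?tb'.
have M0 i j : 0 <= Defs.markov L i j by rewrite mxE.
have n_le m : (n ^ m)%:R <= (Defs.markov L ^+ (k * m)) E E.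
  (* The orbit of D up to time m is finite, so some x inside a J_l avoids it. *)
  pose C := \bigcup_(r in `I_m.+1) (iter r (iter k L) @` D).
  have C_fin : finite_set C.
    by apply: bigcup_finite => [|r _]; [exact: finite_II|exact: finite_image].
  pose l0 := Ordinal hn; have [a0 ab b1] := ab01 l0.
  have [t [abt Ct]] : exists t, a l0 < t < b l0 /\ ~ C (chart G E t).
    apply: exists_notin_finite => // s t abs abt; apply: chart_inj; lra.
  set x := chart G E t in Ct.
  have Jx : (\bigcup_l J l) x.
    by exists l0 => //; exists t => //; rewrite /= in_itv/=; lra.
  have xE : edge G E x by exists t => //; rewrite /= in_itv/=; lra.
  have xv : ~ vertex G x by apply: chart_interior; lra.
  have xC r : (r <= m)%N -> ~ (iter r (iter k L) @` D) x.
    by move=> rm xr; apply: Ct; exists r.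
  (* These n^m distinct points of E are all sent to x by L^(km), so they occur in [zs]. *)
  have [ys [ys_uniq <- ysP]] := horseshoe_preimages JD hJ Jx xC.
  have [zs [zs_le zsP]] := iter_preimages_le (k * m) E vL p0 Lp xE xv.
  apply: le_trans zs_le; rewrite ler_nat; apply: uniq_leq_size => // y yys.
  have [[l _ [s sl <-]] yx] := ysP y yys; apply: zsP.
    exists s => //; have [al abl bl] := ab01 l.
    by move: sl; rewrite /= !in_itv/=; lra.
  by rewrite mulnC iterM.
have n_rho := spectral_radius_lower_bound M0 hk hn n_le.
have n0 : 0 < n%:R :> R by rewrite ltr0n.
(* Positivity is required to turn ln (rho^k) into k ln rho; rho = 0 would give n <= 0^k = 0. *)
have rho0 : 0 < spectral_radius (Defs.markov L).
  rewrite lt_neqAle spectral_radius_ge0 andbT; apply/eqP => rho_eq0.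
  by move: n_rho; rewrite -rho_eq0 expr0n gtn_eqF//= leNgt n0.
rewrite /entropy mulrC ler_pdivrMr ?ltr0n// mulr_natr -lnXn//.
by rewrite ler_ln// posrE exprn_gt0.
Qed.
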